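(* Let $G$ be a group and $N$ a normal subgroup of $G$. Assume that at least one of the following conditions is satisfied: (1) the projection $G\to G/N$ has a section homomorphism $G/N\to G$ (a group homomorphism that is a right inverse of the projection); (2) $G/N$ is finite. Then there exists $C>0$ such that for every $x\in[G,N]$, $$\mathrm{cl}_G(x)\le\mathrm{cl}_{G,N}(x)\le C\cdot\mathrm{cl}_G(x).$$ Moreover, if (1) is satisfied, then one can take $C=3$.
   Context: Commutators are $[g,h]=ghg^{-1}h^{-1}$. A $(G,N)$-commutator is an element $[g,h]$ with $g\in G$, $h\in N$; $[G,N]$ is the subgroup they generate. For $x\in[G,N]$, $\mathrm{cl}_{G,N}(x)$ is the minimal $n\ge0$ such that $x$ is a product of $n$ $(G,N)$-commutators. For $x\in[G,G]$, $\mathrm{cl}_G(x)$ is the minimal $n\ge0$ such that $x$ is a product of $n$ commutators of elements of $G$. *)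

(* Defs.v *)
From HB Require Import structures.
From mathcomp Require Import all_boot all_order all_algebra.
From mathcomp Require Import all_classical all_reals.

Set Implicit Arguments.
Unset Strict Implicit.
Unset Printing Implicit Defensive.

Local Open Scope group_scope.
Local Open Scope quotient_scope.
Local Open Scope classical_set_scope.

HB.mixin Record isConjClosed (G : groupType) (S : {pred G}) := {
  gpredJn : forall g h : G, h \in S -> h ^ g \in S
}.

(* Membership is boolean, as for groupClosed; since the development is
   classical, this is no restriction on the subgroup. *)
#[short(type="normalClosed")]
HB.structure Definition NormalClosed (G : groupType) :=
  {S of isConjClosed G S & GroupClosed G S}.

Section QuotientGroup.
Variables (G : groupType) (N : normalClosed G).

Definition eqmodg (x y : G) : bool := x^-1 * y \in N.

Lemma eqmodg_equiv : equiv_class_of eqmodg.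
Proof.
split=> [x|x y|y x z]; rewrite /eqmodg.
- by rewrite mulVg gpred1.
- by rewrite -gpredV invgM invgK.
- by move=> xy yz; rewrite -[z](mulVKg y) mulgA gpredM.
Qed.

Canonical eqmodg_equivRel := EquivRelPack eqmodg_equiv.

Definition quotg := {eq_quot eqmodg_equivRel}.
HB.instance Definition _ := Choice.on quotg.
HB.instance Definition _ := EqQuotient.on quotg.

Definition quotg_proj (x : G) : quotg := \pi x.

Lemma quotg_projP (x y : G) :
  reflect (quotg_proj x = quotg_proj y) (x^-1 * y \in N).
Proof. exact: (@eqmodP _ eqmodg_equivRel). Qed.

Lemma quotg_reprK : cancel (@repr G quotg) quotg_proj.
Proof. exact: reprK. Qed.

Definition quotg_one : quotg := quotg_proj 1.
Definition quotg_inv (a : quotg) : quotg := quotg_proj (repr a)^-1.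
Definition quotg_mul (a b : quotg) : quotg := quotg_proj (repr a * repr b).

Lemma quotg_projM (x y : G) :
  quotg_mul (quotg_proj x) (quotg_proj y) = quotg_proj (x * y).
Proof.
rewrite /quotg_mul; apply/quotg_projP.
have /quotg_projP := quotg_reprK (quotg_proj x).
have /quotg_projP := quotg_reprK (quotg_proj y).
move: (repr (quotg_proj x)) (repr (quotg_proj y)) => x' y' hy hx.
have -> : (x' * y')^-1 * (x * y) = (x'^-1 * x) ^ y' * (y'^-1 * y).
  by rewrite conjgE invgM !mulgA mulgK.
by rewrite gpredM // gpredJn.
Qed.

Lemma quotg_projV (x : G) : quotg_inv (quotg_proj x) = quotg_proj x^-1.
Proof.
rewrite /quotg_inv; apply/quotg_projP; rewrite invgK.
have /quotg_projP := quotg_reprK (quotg_proj x).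
move: (repr _) => x' /(gpredJn x'^-1).
by rewrite conjgE invgK mulgA mulVKg -gpredV invgM invgK.
Qed.

Lemma quotg_mulA : associative quotg_mul.
Proof.
move=> a b c.
rewrite -(quotg_reprK a) -(quotg_reprK b) -(quotg_reprK c).
by rewrite !quotg_projM mulgA.
Qed.

Lemma quotg_mul1g : left_id quotg_one quotg_mul.
Proof. by move=> a; rewrite -(quotg_reprK a) quotg_projM mul1g. Qed.

Lemma quotg_mulg1 : right_id quotg_one quotg_mul.
Proof. by move=> a; rewrite -(quotg_reprK a) quotg_projM mulg1. Qed.

Lemma quotg_mulVg : left_inverse quotg_one quotg_inv quotg_mul.
Proof.
by move=> a; rewrite -(quotg_reprK a) quotg_projV quotg_projM mulVg.
Qed.

Lemma quotg_mulgV : right_inverse quotg_one quotg_inv quotg_mul.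
Proof.
by move=> a; rewrite -(quotg_reprK a) quotg_projV quotg_projM mulgV.
Qed.

HB.instance Definition _ := isGroup.Build quotg
  quotg_mulA quotg_mul1g quotg_mulg1 quotg_mulVg quotg_mulgV.

Lemma quotg_proj_monoid : monoid_morphism quotg_proj.
Proof. by split=> // x y; rewrite -quotg_projM. Qed.

HB.instance Definition _ :=
  isUMagmaMorphism.Build G quotg quotg_proj quotg_proj_monoid.

End QuotientGroup.

Section CommutatorLength.
Variable G : groupType.

(* Not the library's [~ g, h], which is g^-1 * h^-1 * g * h. *)
Definition commutator (g h : G) : G := g * h * g^-1 * h^-1.

Definition commutators : set G :=
  [set c | exists g h, c = commutator g h].

Definition rel_commutators (N : normalClosed G) : set G :=
  [set c | exists g h, h \in N /\ c = commutator g h].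

Inductive generated (A : set G) : set G :=
| generated_base x : A x -> generated A x
| generated_one : generated A 1
| generated_mul x y : generated A x -> generated A y -> generated A (x * y)
| generated_inv x : generated A x -> generated A x^-1.

Definition mixed_commutator_subgroup (N : normalClosed G) : set G :=
  generated (rel_commutators N).

Definition is_product (A : set G) (n : nat) (x : G) : Prop :=
  exists c : 'I_n -> G, (forall i, A (c i)) /\ x = \prod_(i < n) c i.

(* The value is 0 when x is not a product of elements of A. *)
Definition word_length (A : set G) (x : G) : nat :=
  xget 0%N
    [set n | is_product A n x /\ forall m, is_product A m x -> (n <= m)%N].

Definition cl (x : G) : nat := word_length commutators x.

Definition rel_cl (N : normalClosed G) (x : G) : nat :=
  word_length (rel_commutators N) x.

End CommutatorLength.

Definition has_section_hom (G : groupType) (N : normalClosed G) : Prop :=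
  exists s : UMagmaMorphism.type (quotg N) G,
    forall q : quotg N, quotg_proj N (s q) = q.

(* Main.v *)
Require Import Defs.
From mathcomp Require Import all_boot all_order all_algebra.
From mathcomp Require Import all_classical all_reals.

(* Fix representatives t(g) of the cosets gN.  Each commutator [g, h] equals
   [t(g), t(h)] times two (G, N)-commutators, and the set of (G, N)-commutators
   is conjugation-invariant, so a product of n commutators equals a product of
   n commutators of representatives times 2n (G, N)-commutators.

   If t comes from a section homomorphism, the product of commutators of
   representatives is the image under t of an element of N, hence trivial;
   this gives the constant 2.

   If G/N is finite, only finitely many commutators of representatives occur,
   and Schur's argument bounds the length modulo [G, N]: in a long product one
   of them, c, occurs m + 1 times with c^m in N, and c^(m+1) is modulo [G, N]
   a product of m commutators.  Hence a product of n commutators is a product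
   of at most L commutators of representatives times O(n) (G, N)-commutators,
   and only finitely many elements of [G, N] are products of L commutators of
   representatives. *)

(** * Products of elements of a set and word length *)

Section WordLength.
Set Implicit Arguments.
Unset Strict Implicit.
Local Open Scope group_scope.
Variable G : groupType.
Implicit Types (A B : set G) (x y g h : G) (n : nat).

Lemma is_product0 A : is_product A 0 1.
Proof.
by exists (fun=> 1); split; [case | rewrite big_ord0].
Qed.

Lemma is_product_cons A n c x :
  A c -> is_product A n x -> is_product A n.+1 (c * x).
Proof.
move=> Ac [d [Ad ->]].
exists (fun i => oapp d c (unlift ord0 i)); split=> [i|].
  by case: (unlift ord0 i).
rewrite big_ord_recl unlift_none /=; congr (_ * _).
by apply: eq_bigr => i _; rewrite liftK.
Qed.

Lemma is_product_ind A (P : nat -> G -> Prop) :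
    P 0 1 ->
    (forall n c x, A c -> is_product A n x -> P n x -> P n.+1 (c * x)) ->
  forall n x, is_product A n x -> P n x.
Proof.
move=> P0 PS; elim=> [|n IHn] x [d [Ad ->]]; first by rewrite big_ord0.
rewrite big_ord_recl.
have Ax : is_product A n (\prod_(i < n) d (lift ord0 i)).
  by exists (fun i => d (lift ord0 i)).
by apply: PS => //; exact: IHn.
Qed.

Lemma is_product1 A c : A c -> is_product A 1 c.
Proof. by move=> Ac; rewrite -[c]mulg1; apply: is_product_cons (is_product0 A). Qed.

Lemma is_productM A m n x y :
  is_product A m x -> is_product A n y -> is_product A (m + n) (x * y).
Proof.
move=> Ax Ay; elim/is_product_ind: m x / Ax => [|m c x Ac _ IH].
  by rewrite mul1g.
by rewrite -mulgA addSn; apply: is_product_cons.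
Qed.

Lemma is_productX A n c : A c -> is_product A n (c ^+ n).
Proof.
move=> Ac; elim: n => [|n IHn]; first exact: is_product0.
by rewrite expgS; apply: is_product_cons.
Qed.

Lemma is_product_seq A n x :
    is_product A n x ->
  exists s, [/\ size s = n, forall c, c \in s -> A c & x = \prod_(c <- s) c].
Proof.
move=> Ax; elim/is_product_ind: n x / Ax => [|n c x Ac _ [s [<- As ->]]].
  by exists [::]; rewrite big_nil.
exists (c :: s); rewrite big_cons; split=> // d.
by rewrite inE => /predU1P[-> //|/As].
Qed.

Lemma is_product_sub A B n x :
  (forall c, A c -> B c) -> is_product A n x -> is_product B n x.
Proof. by move=> AB [d [Ad ->]]; exists d; split=> // i; apply: AB. Qed.

Lemma is_product_leq A m n x :
  A 1 -> (m <= n)%N -> is_product A m x -> is_product A n x.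
Proof.
move=> A1 lemn Ax; rewrite -(subnKC lemn) -[x]mulg1.
by apply: is_productM => //; rewrite -(expg1n G (n - m)); apply: is_productX.
Qed.

Lemma is_productJ A g n x :
  (forall c, A c -> A (c ^ g)) -> is_product A n x -> is_product A n (x ^ g).
Proof.
move=> AJ Ax; elim/is_product_ind: n x / Ax => [|n c x Ac _ IH].
  by rewrite conj1g; apply: is_product0.
by rewrite conjMg; apply: is_product_cons => //; apply: AJ.
Qed.

Lemma is_productV A n x :
  (forall c, A c -> A c^-1) -> is_product A n x -> is_product A n x^-1.
Proof.
move=> AV Ax; elim/is_product_ind: n x / Ax => [|n c x Ac _ IH].
  by rewrite invg1; apply: is_product0.
by rewrite invgM -addn1; apply: is_productM => //; apply/is_product1/AV.
Qed.

Lemma is_product_generated A x :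
  (forall c, A c -> A c^-1) -> generated A x -> exists n, is_product A n x.
Proof.
move=> AV; elim=> [c Ac||y z _ [m Ay] _ [n Az]|y _ [n Ay]].
- by exists 1%N; apply: is_product1.
- by exists 0%N; apply: is_product0.
- by exists (m + n)%N; apply: is_productM.
- by exists n; apply: is_productV.
Qed.

(** The set of admissible lengths is nonempty, so it has a minimum and [xget] does not fall back on
    its default. *)
Lemma word_lengthP A n x :
  is_product A n x -> is_product A (word_length A x) x /\ (word_length A x <= n)%N.
Proof.
move=> Ax; rewrite /word_length; set P := (X in xget _ X).
have exP : exists k, P k.
  have exb : exists k, `[< is_product A k x >] by exists n; apply/asboolP.
  case: (ex_minnP exb) => k /asboolP Ak kmin; exists k; split=> // j Aj.
  by apply/kmin/asboolP.
by have [Ak kmin] := xgetPex 0%N exP; split=> //; apply: kmin.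
Qed.

(* Conjugation by [w ^+ k] lets occurrences of [w] be pulled to the front. *)
Lemma prod_extract A (s : seq G) w k :
    (forall c g, A c -> A (c ^ g)) -> (forall c, c \in s -> A c) ->
    (k <= count_mem w s)%N ->
  exists2 y, is_product A (size s - k) y & \prod_(c <- s) c = w ^+ k * y.
Proof.
move=> AJ; elim: s k => [|c s IHs] k As /= lek.
  move: lek; rewrite leqn0 => /eqP ->; exists 1; first exact: is_product0.
  by rewrite big_nil mulg1.
have As' d : d \in s -> A d by move=> sd; apply: As; rewrite inE sd orbT.
have {}IHs j := IHs j As'.
have Ac : A c by apply: As; exact: mem_head.
rewrite big_cons; case: eqP lek => [cw|_]; rewrite ?add1n ?add0n.
  rewrite {c As}cw in Ac *; case: k => [|k] lek; last first.
    by have [y Ay ->] := IHs k lek; exists y; rewrite // expgS mulgA.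
  have [y Ay ->] := IHs 0%N isT; exists (w * y); rewrite ?expg0 ?mul1g //.
  by move: Ay; rewrite !subn0; apply: is_product_cons.
move=> lek; have [y Ay ->] := IHs k lek.
exists (c ^ (w ^+ k) * y); last by rewrite mulgA [c * _]conjgC -mulgA.
rewrite subSn ?(leq_trans lek) ?count_size //.
by apply: is_product_cons => //; apply: AJ.
Qed.

Lemma exists_max (T : eqType) (s : seq T) (P : T -> nat -> Prop) :
    (forall i m n, (m <= n)%N -> P i m -> P i n) ->
    (forall i, i \in s -> exists n, P i n) ->
  exists n, forall i, i \in s -> P i n.
Proof.
move=> Pmono; elim: s => [|i s IHs] exP; first by exists 0%N.
have [j sj|m Pm] := IHs; first by apply: exP; rewrite inE sj orbT.
have [n Pn] := exP i (mem_head _ _).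
exists (maxn m n) => j; rewrite inE => /predU1P[->|sj].
  exact: Pmono (leq_maxr _ _) Pn.
exact: Pmono (leq_maxl _ _) (Pm j sj).
Qed.

(** If the head of [W] occurs at most [m] times, deleting it from [s] leaves a list still long
    enough for the tail of [W]. *)
Lemma pigeonhole_count (T : eqType) (W s : seq T) m :
    {subset s <= W} -> (m * size W < size s)%N ->
  exists2 w, w \in W & (m < count_mem w s)%N.
Proof.
elim: W s => [|w W IHW] s sW /=.
  by case: s sW => // c s /(_ c (mem_head _ _)).
have [lt_mw _|le_wm lts] := ltnP m (count_mem w s).
  by exists w; rewrite ?mem_head.
have [||v Wv ltv] := IHW [seq c <- s | c != w].
- move=> c; rewrite mem_filter => /andP[/negPf cw /sW].
  by rewrite inE cw.
- move: lts; rewrite size_filter -(count_predC (pred1 w) s) mulnS => lts.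
  by rewrite -(ltn_add2l m) (leq_trans lts) // leq_add2r.
exists v; first by rewrite inE Wv orbT.
by apply: leq_trans ltv _; rewrite count_filter; apply: sub_count => c /andP[].
Qed.

(** Only finitely many words of length [n] over [W] exist; the induction takes a common bound over
    the first letters. *)
Lemma is_product_bound (W : seq G) (P : G -> nat -> Prop) n :
    (forall x a b, (a <= b)%N -> P x a -> P x b) ->
    (forall x, is_product [set` W]%classic n x -> exists b, P x b) ->
  exists b, forall x, is_product [set` W]%classic n x -> P x b.
Proof.
move=> Pmono; elim: n P Pmono => [|n IHn] P Pmono exP.
  have [b Pb] := exP 1 (is_product0 _).
  by exists b => x [d [_ ->]]; rewrite big_ord0.
have [|c Wc|b Pb] := @exists_max G W
  (fun c b => forall x, is_product [set` W]%classic n x -> P (c * x) b).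
- by move=> c i j leij Pi x Wx; apply: Pmono leij _; apply: Pi.
- apply: IHn => [x|x Wx]; first exact: Pmono.
  by apply: exP; apply: is_product_cons.
exists b => x [d [Wd ->]]; rewrite big_ord_recl.
by apply: Pb; [exact: Wd | exists (fun i => d (lift ord0 i))].
Qed.

End WordLength.

(** * Relative commutators *)

Section MixedCommutators.
Set Implicit Arguments.
Unset Strict Implicit.
Local Open Scope group_scope.
Variables (G : groupType) (N : normalClosed G).
Implicit Types (x y g h z : G) (n : nat).

Local Notation mixed n := (is_product (rel_commutators N) n).
Local Notation product n := (is_product (@commutators G) n).

Let wordE := (@conjgE G, @mulgA G, @invgM G, @invgK G, @mulgK G, @mulgVK G,
  @mulgV G, @mulVg G, @mul1g G, @mulg1 G, @invg1 G).

Lemma commutatorJ g h z : commutator g h ^ z = commutator (g ^ z) (h ^ z).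
Proof. by rewrite /commutator !wordE. Qed.

Lemma commutator1 : commutator 1 1 = 1 :> G.
Proof. by rewrite /commutator !wordE. Qed.

Lemma commutators1 : commutators (1 : G).
Proof. by exists 1, 1; rewrite commutator1. Qed.

Lemma commutatorsJ z x : commutators x -> commutators (x ^ z).
Proof. by move=> [g [h ->]]; exists (g ^ z), (h ^ z); rewrite commutatorJ. Qed.

Lemma rel_commutators1 : rel_commutators N 1.
Proof. by exists 1, 1; rewrite commutator1 gpred1. Qed.

Lemma rel_commutatorsJ z x : rel_commutators N x -> rel_commutators N (x ^ z).
Proof.
move=> [g [h [Nh ->]]]; exists (g ^ z), (h ^ z).
by rewrite commutatorJ gpredJn.
Qed.

(** The identity is [g, h]^-1 = [g^-1, g h g^-1]. *)
Lemma rel_commutatorsV x : rel_commutators N x -> rel_commutators N x^-1.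
Proof.
move=> [g [h [Nh ->]]]; exists g^-1, (h ^ g^-1).
by rewrite gpredJn //; split=> //; rewrite /commutator !wordE.
Qed.

Lemma rel_commutators_swap g h : h \in N -> rel_commutators N (commutator h g).
Proof.
move=> Nh; have -> : commutator h g = (commutator g h)^-1.
  by rewrite /commutator !wordE.
by apply: rel_commutatorsV; exists g, h.
Qed.

Lemma rel_commutators_in x : rel_commutators N x -> x \in N.
Proof.
move=> [g [h [Nh ->]]]; rewrite /commutator gpredM ?gpredV //.
by have := gpredJn g^-1 _ Nh; rewrite !wordE.
Qed.

Lemma mixed_leq m n x : (m <= n)%N -> mixed m x -> mixed n x.
Proof. exact: is_product_leq rel_commutators1. Qed.

Lemma mixedJ n z x : mixed n x -> mixed n (x ^ z).
Proof. by apply: is_productJ => c; exact: rel_commutatorsJ. Qed.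

Lemma mixed_subgroupP x :
  mixed_commutator_subgroup N x <-> exists n, mixed n x.
Proof.
split; first exact/is_product_generated/rel_commutatorsV.
move=> [n Mx]; elim/is_product_ind: n x / Mx => [|n c x Mc _ IH].
  exact: generated_one.
by apply: generated_mul IH; apply: generated_base.
Qed.

Lemma mixed_subgroup_in x : mixed_commutator_subgroup N x -> x \in N.
Proof.
elim=> [c|||]; [exact: rel_commutators_in | exact: gpred1 | |].
  by move=> y z _ Ny _ Nz; rewrite gpredM.
by move=> y _ Ny; rewrite gpredV.
Qed.

Lemma mixed_product n x : mixed n x -> product n x.
Proof. by apply: is_product_sub => c [g [h [_ ->]]]; exists g, h. Qed.

(** * Passage to coset representatives *)

Section Representatives.
Variable t : G -> G.
Hypothesis tN : forall g, (t g)^-1 * g \in N.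

Definition repr_commutators : set G :=
  [set c | exists g h, c = commutator (t g) (t h)]%classic.

Lemma commutator_repr g h :
  exists2 m, mixed 2 m & commutator g h = commutator (t g) (t h) * m.
Proof.
set a := t g; set b := t h; set c := commutator a b.
set u := a^-1 * g; set v := b^-1 * h.
(* From [a u, h] = a [u, h] a^-1 [a, h] and [a, b v] = [a, b] b [a, v] b^-1; a further conjugation
   by [c] brings [c] to the front. *)
exists (commutator u h ^ (a^-1 * c) * commutator a v ^ b^-1).
  apply: (@is_productM _ _ 1 1); apply: is_product1.
    by apply/rel_commutatorsJ/rel_commutators_swap; exact: tN.
  by apply: rel_commutatorsJ; exists a, v; split=> //; exact: tN.
by rewrite /c /u /v /commutator !wordE.
Qed.

Lemma product_repr n x :
    product n x ->
  exists y m, [/\ is_product repr_commutators n y, mixed (2 * n) m & x = y * m].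
Proof.
move=> Cx; elim/is_product_ind: n x / Cx => [|n _ x [g [h ->]] _].
  by exists 1, 1; rewrite mulg1; split=> //; apply: is_product0.
move=> [y [m [Ry Mm ->]]]; have [m' Mm' ->] := commutator_repr g h.
(* [m'] moves to the right of [y] by conjugation. *)
exists (commutator (t g) (t h) * y), (m' ^ y * m); split.
- by apply: is_product_cons => //; exists g, h.
- by rewrite mulnS; apply: is_productM => //; apply: mixedJ.
by rewrite !wordE.
Qed.

End Representatives.

(* A homomorphic section fixes every product of commutators of
   representatives, so such a product is trivial as soon as it lies in [N]. *)
Lemma section_bound n x :
  has_section_hom N -> x \in N -> product n x -> mixed (2 * n) x.
Proof.
move=> [s sK] Nx Cx; pose t g := s (quotg_proj N g).
have tN g : (t g)^-1 * g \in N by apply/quotg_projP; rewrite sK.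
have [y [m [Ry Mm xE]]] := product_repr tN Cx.
have tM g h : t (g * h) = t g * t h by rewrite /t !gmulfM.
have tV g : t g^-1 = (t g)^-1 by rewrite /t !gmulfV.
have t_idem g : t (t g) = t g by rewrite /t sK.
have ty : t y = y.
  elim/is_product_ind: n y / Ry {Cx Mm xE} => [|n _ z [g [h ->]] _ IH].
    by rewrite /t !gmulf1.
  by rewrite tM IH /commutator !tM !tV !t_idem.
have Ny : y \in N.
  have /mixed_subgroup_in Nm : mixed_commutator_subgroup N m.
    by apply/mixed_subgroupP; exists (2 * n)%N.
  by rewrite -(gpredMr y Nm) -xE.
(* The coset of [y] is trivial, so y = t(y) = 1 and x = m. *)
rewrite xE -ty; suff -> : t y = 1 by rewrite mul1g.
rewrite /t; suff -> : quotg_proj N y = quotg_proj N 1 by rewrite !gmulf1.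
by apply/esym/quotg_projP; rewrite invg1 mul1g.
Qed.

(* With [c = [a, b]] and [c ^+ m] central modulo [G, N], Schur's identity
   [c ^+ m.+1 = [a, b ^+ 2] * (c ^+ m.-1) ^ b^-1] holds modulo [G, N]. *)
Lemma commutator_expS c m :
    commutators c -> (0 < m)%N -> c ^+ m \in N ->
  exists p u, [/\ product m p, mixed 1 u & c ^+ m.+1 = p * u].
Proof.
case: m => // m [a [b cE]] _ Nc.
(* Here [m] is the predecessor of the given exponent. This product equals c b c^(m+1) b^-1, and the
   commutator of [b] with c^-(m+1) corrects it to c^(m+2). *)
exists (commutator a (b * b) * (c ^+ m) ^ b^-1).
exists (commutator b (c ^- m.+1)); split.
- rewrite -add1n; apply: is_productM; first by apply: is_product1; exists a, (b * b).
  by apply: is_productJ; [exact: commutatorsJ | apply: is_productX; exists a, b].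
- by apply: is_product1; exists b, (c ^- m.+1); rewrite gpredV.
by rewrite !expgS; set d := c ^+ m; rewrite cE /commutator !wordE.
Qed.

(** * Finite quotient: Schur's argument *)

Section FiniteQuotient.
Hypothesis quot_fin : finite_set [set: quotg N]%classic.

Lemma quot_enum : exists Q : seq (quotg N), forall a, a \in Q.
Proof.
have [Q QT] := (finite_seqP _).1 quot_fin.
by exists Q => a; have : [set` Q]%classic a by rewrite -QT.
Qed.

(** Two of the first |Q| + 1 powers of [g] share a coset, where [Q] lists the quotient. *)
Lemma exp_in_normal g : exists2 m, (0 < m)%N & g ^+ m \in N.
Proof.
have [Q Qall] := quot_enum.
pose f i := quotg_proj N (g ^+ i).
have /(uniqPn (f 0%N))[i [j [ltij]]] : ~~ uniq [seq f i | i <- iota 0 (size Q).+1].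
  apply/negP => /uniq_leq_size/(_ (fun a _ => Qall a)).
  by rewrite size_map size_iota ltnn.
rewrite size_map size_iota => ltj.
rewrite !(nth_map 0%N) ?size_iota ?(ltn_trans ltij) //.
rewrite !nth_iota ?(ltn_trans ltij) // !add0n => /quotg_projP Nij.
exists (j - i)%N; first by rewrite subn_gt0.
by rewrite -(subnKC (ltnW ltij)) expgnDr mulKg in Nij.
Qed.

Lemma product_bound_finite :
  exists C, forall n x,
    mixed_commutator_subgroup N x -> product n x -> mixed (C * n) x.
Proof.
have [Q Qall] := quot_enum.
pose t g := repr (quotg_proj N g).
have tN g : (t g)^-1 * g \in N by apply/quotg_projP; rewrite quotg_reprK.
pose W := [seq commutator (repr a) (repr b) | a <- Q, b <- Q].
have RW c : repr_commutators t c -> c \in W.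
  by move=> [g [h ->]]; apply/allpairsP; exists (quotg_proj N g, quotg_proj N h).
have WC c : c \in W -> commutators c.
  by move=> /allpairsP[[a b] [_ _ ->]]; exists (repr a), (repr b).
have [m m_gt0 Wm] : exists2 m, (0 < m)%N & forall w, w \in W -> w ^+ m \in N.
  have [|w _|b Wb] := @exists_max G W
      (fun w b => exists m, [/\ 0 < m, m <= b & w ^+ m \in N])%N.
  - move=> w i j leij [m [m0 mi Nm]].
    by exists m; split=> //; apply: leq_trans leij.
  - by have [m m0 Nm] := exp_in_normal w; exists m, m.
  (* Every individual exponent is at most [b], hence divides this factorial. *)
  exists b`!; first exact: fact_gt0.
  move=> w /Wb[m [m0 mb Nm]].
  have /dvdnP[q ->] : m %| b`! by rewrite dvdn_fact // m0.
  by rewrite mulnC expgnA gpredXn.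
(* Among [L.+1] letters of [W] one occurs [m.+1] times. [K] counts 2(L + 1) relative commutators
   from passing to representatives and one from Schur's identity. *)
pose L := (m * size W)%N; pose K := (2 * L.+1).+1.
have reduce x : product L.+1 x ->
    exists p u, [/\ product L p, mixed K u & x = p * u].
  move=> /(product_repr tN)[y [v [Ry Mv ->]]].
  have [s [sz sR ->]] := is_product_seq Ry.
  have [|w Ww cw] := @pigeonhole_count _ W s m (fun c sc => RW c (sR c sc)).
    by rewrite sz.
  have sC c : c \in s -> commutators c by move=> /sR/RW/WC.
  have [z Cz ->] := prod_extract (fun c g => @commutatorsJ g c) sC cw.
  have [p [u [Cp Mu ->]]] := commutator_expS (WC w Ww) m_gt0 (Wm w Ww).
  exists (p * z), (u ^ z * v); split; last by rewrite !wordE.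
    (* [m] commutators replace [m.+1] letters, so the total drops to [L]. *)
    have lem : (m <= L)%N by rewrite -ltnS -sz (leq_trans cw) ?count_size.
    by rewrite -(subnKC lem) -subSS -sz; apply: is_productM.
  by rewrite /K -add1n; apply: is_productM => //; apply: mixedJ.
have split_product n x : product n x ->
    exists p u, [/\ product L p, mixed (K * n) u & x = p * u].
  move=> Cx; elim/is_product_ind: n x / Cx => [|n c x Cc _ [p [u [Cp Mu ->]]]].
    exists 1, 1; rewrite muln0 mulg1; split=> //; last exact: is_product0.
    by apply: (is_product_leq commutators1 (leq0n L)); apply: is_product0.
  (* Each new factor is absorbed at cost [K]. *)
  have [p' [u' [Cp' Mu' cpE]]] := reduce _ (is_product_cons Cc Cp).
  exists p', (u' * u); split=> //; last by rewrite mulgA cpE mulgA.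
  by rewrite mulnS; apply: is_productM.
(* Words outside [G, N] satisfy the predicate vacuously. *)
have [||b Wb] := @is_product_bound G W
    (fun y b => mixed_commutator_subgroup N y -> mixed b y) L.
- by move=> x i j leij Mi /Mi; apply: mixed_leq.
- move=> y _; have [|nMy] := pselect (mixed_commutator_subgroup N y).
    by move=> /mixed_subgroupP[j Mj]; exists j.
  by exists 0%N.
(* The fixed cost b + 2 L is at most its multiple by a positive length; length 0 is treated
   apart. *)
exists (b + 2 * L + K)%N => n x Sx Cx; case: n Cx => [|n] Cx.
  case: Cx => d [_ ->]; rewrite big_ord0 muln0; exact: is_product0.
have [p [u [Cp Mu xE]]] := split_product _ _ Cx.
have [y [v [Ry Mv pE]]] := product_repr tN Cp.
have My : mixed b y.
  apply: Wb; first by apply: is_product_sub Ry => c /RW.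
  have -> : y = x * (u^-1 * v^-1) by rewrite xE pE !wordE.
  apply: generated_mul => //.
  by apply: generated_mul; apply: generated_inv; apply/mixed_subgroupP;
    [exists (K * n.+1)%N | exists (2 * L)%N].
rewrite xE pE; apply: mixed_leq (is_productM (is_productM My Mv) Mu).
by rewrite mulnDl leq_add2r leq_pmulr.
Qed.

End FiniteQuotient.

(** * Comparison of the two lengths *)

Lemma cl_le_rel_cl x : mixed_commutator_subgroup N x -> (cl x <= rel_cl N x)%N.
Proof.
move=> /mixed_subgroupP[n /word_lengthP[/mixed_product Cx _]].
by have [] := word_lengthP Cx.
Qed.

Lemma rel_cl_le C x :
    (forall n, product n x -> mixed (C * n) x) ->
  mixed_commutator_subgroup N x -> (rel_cl N x <= C * cl x)%N.
Proof.
move=> CM /mixed_subgroupP[n /mixed_product/word_lengthP[/CM Mx _]].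
by have [] := word_lengthP Mx.
Qed.

End MixedCommutators.

Import GRing.Theory Num.Theory.

Local Open Scope ring_scope.
Local Open Scope classical_set_scope.

Theorem theorem1p7 (R : realType) (G : groupType) (N : normalClosed G) :
  has_section_hom N \/ finite_set [set: quotg N] ->
  (exists C : R, 0 < C /\
     forall x : G, mixed_commutator_subgroup N x ->
       (cl x <= rel_cl N x)%N /\ (rel_cl N x)%:R <= C * (cl x)%:R) /\
  (has_section_hom N ->
     forall x : G, mixed_commutator_subgroup N x ->
       (cl x <= rel_cl N x)%N /\ (rel_cl N x)%:R <= 3 * (cl x)%:R :> R).
Proof.
have section_case : has_section_hom N -> forall x : G,
    mixed_commutator_subgroup N x ->
    (cl x <= rel_cl N x)%N /\ (rel_cl N x)%:R <= 3 * (cl x)%:R :> R.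
  move=> Ns x Mx; split; first exact: cl_le_rel_cl.
  rewrite -natrM ler_nat; apply: rel_cl_le (Mx) => n Cx.
  apply: (@mixed_leq _ _ (2 * n)); first by rewrite leq_mul2r orbT.
  by apply: section_bound => //; apply: mixed_subgroup_in.
move=> hyp; split=> //; case: hyp => [Ns|Nfin].
  by exists 3; split=> //; apply: section_case.
have [C CM] := product_bound_finite Nfin.
(* The successor ensures positivity, as [C] may be 0. *)
exists C.+1%:R; split=> [|x Mx]; first by rewrite ltr0n.
split; first exact: cl_le_rel_cl.
rewrite -natrM ler_nat; apply: leq_trans (leq_mul (leqnSn C) (leqnn _)).
by apply: rel_cl_le => // n; apply: CM.
Qed.
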